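(* Consider the Weibull source over a countable set of types $\mathbb{W}$, with scale parameters $\lambda_w>0$ and shape parameters $\alpha_w\in(0,1]$, $w\in\mathbb{W}$. For every $t>0$ and $k\in\mathbb{N}$, $$\mathbf{E}\, V_W(t)=\sum_{w\in\mathbb{W}}\left(1-e^{-(t/\lambda_w)^{\alpha_w}}\right),$$ $$\mathbf{E}\, V_W(t|k)\le\sum_{w\in\mathbb{W}}\frac{\Gamma(\alpha_w+1)^k}{\Gamma(k\alpha_w+1)}\left(\frac{t}{\lambda_w}\right)^{k\alpha_w}e^{-(t/\lambda_w)^{\alpha_w}},$$ and, provided that $\mathbf{E}\,V_W(s)<\infty$ for all $s>0$, $$(-1)^{k+1}t^k\frac{d^k}{dt^k}\mathbf{E}\, V_W(t)\ge\sum_{w\in\mathbb{W}}\alpha_w^k\left(\frac{t}{\lambda_w}\right)^{k\alpha_w}e^{-(t/\lambda_w)^{\alpha_w}}.$$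
   Context: The Weibull source is defined as follows. For each type $w\in\mathbb{W}$, let $(Y^w_i)_{i}$ be an IID sequence of positive random variables with the Weibull distribution $$P(Y^w_i\le y)=\int_0^y\frac{\alpha_w}{\lambda_w}\left(\frac{s}{\lambda_w}\right)^{\alpha_w-1}e^{-(s/\lambda_w)^{\alpha_w}}ds=1-e^{-(y/\lambda_w)^{\alpha_w}},\quad y\ge 0,$$ the sequences for different $w$ being independent. The number of occurrences of type $w$ in $(0,t]$ is $N^W_w((0,t]):=\#\{k\ge 1:\sum_{i=1}^k Y^w_i\le t\}$ for $t>0$. The number of types is $V_W(t):=\sum_{w\in\mathbb{W}}\mathbf{1}\{N^W_w((0,t])>0\}$ and the spectrum elements are $V_W(t|k):=\sum_{w\in\mathbb{W}}\mathbf{1}\{N^W_w((0,t])=k\}$. $\Gamma$ is the Euler gamma function and $\mathbb{N}=\{1,2,\ldots\}$. Expectations and sums of nonnegative terms take values in $[0,\infty]$. *)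

(* Defs.v *)
(* MathComp / MathComp-Analysis *)
From HB Require Import structures.
From mathcomp Require Import all_boot all_order all_algebra finmap.
From mathcomp Require Import all_classical all_reals all_analysis.
Set Implicit Arguments.
Unset Strict Implicit.
Unset Printing Implicit Defensive.
Import Order.TTheory GRing.Theory Num.Theory.
Import numFieldNormedType.Exports.

Local Open Scope classical_set_scope.
Local Open Scope ring_scope.

(* The intended domain is 0 < x: [\int] is real-valued, so the value is the
   default 0 where the integral diverges. *)
Definition euler_gamma (R : realType) (x : R) : R :=
  \int[lebesgue_measure]_(s in `]0%R, +oo[) (s `^ (x - 1) * expR (- s)).

Section independence.
Context (d : measure_display) (T : measurableType d) (R : realType).
Variable P : probability T R.

Definition independent_classes (I : choiceType) (F : I -> set (set T)) : Prop :=
  forall (J : {fset I}) (A : I -> set T),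
    (forall i, i \in J -> F i (A i)) ->
    P (\bigcap_(i in [set` J]) A i) = (\prod_(i <- J) P (A i))%E.

Definition independent_RVs (I : choiceType) (X : I -> {RV P >-> R}) : Prop :=
  independent_classes (fun i => g_sigma_algebra_preimage (X i)).

Definition sequence_sigma_algebra (X : nat -> {RV P >-> R}) : set (set T) :=
  <<s \bigcup_i g_sigma_algebra_preimage (X i) >>.

Definition independent_sequences (I : choiceType)
    (X : I -> nat -> {RV P >-> R}) : Prop :=
  independent_classes (fun i => sequence_sigma_algebra (X i)).

End independence.

Section weibull_source.
Context (d : measure_display) (T : measurableType d) (R : realType).
Variables (P : probability T R) (W : countType).
Implicit Types (Y : W -> nat -> {RV P >-> R}) (t : R) (x : T).

(* Sequences are indexed from 0: [Y w i] is the (i+1)-st waiting time of type w.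
   The common cdf of the [Y w i] makes them identically distributed; on y < 0 it
   is 0 because waiting times are positive. *)
Record weibull_source (lam alpha : W -> R) Y : Prop := WeibullSource {
  waiting_time_gt0 : forall w i x, 0 < Y w i x;
  waiting_time_cdf : forall w i (y : R), 0 <= y ->
    cdf (Y w i) y = (1 - expR (- ((y / lam w) `^ alpha w)))%:E;
  waiting_time_indep : forall w, independent_RVs (Y w);
  types_indep : independent_sequences Y
}.

(* Takes the value +oo when infinitely many occurrences fall in (0,t]. *)
Definition occurrences Y w t x : \bar R :=
  counting [set k : nat | (1 <= k)%N /\ \sum_(i < k) Y w i x <= t].

Definition num_types Y t x : \bar R :=
  \esum_(w in [set: W]) (\1_[set v | (0 < occurrences Y v t x)%E] w)%:E.

Definition spectrum Y t (k : nat) x : \bar R :=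
  \esum_(w in [set: W]) (\1_[set v | occurrences Y v t x = k%:R%:E] w)%:E.

(* [expectation] is restricted to real-valued functions, hence the integrals. *)
Definition mean_num_types Y t : \bar R := \int[P]_x num_types Y t x.

Definition mean_spectrum Y t (k : nat) : \bar R := \int[P]_x spectrum Y t k x.

End weibull_source.

(* Main.v *)
(* Weibull waiting times with parameters (a, l) are l * E ^ (1 / a) with E
   exponential.  Let S_k be the k-th partial sum.  Conditioning successively on
   the last waiting time, P(S_k <= t < S_(k+1)) is a k-fold iterated integral of
   s |-> expR (- (s / l) ^ a) over 0 <= s <= t.  As a <= 1, x |-> x ^ a is
   subadditive, so all the exponential factors together are at most
   expR (- (t / l) ^ a), and what remains is a Dirichlet integral, a product of
   Beta integrals that telescopes to Gamma(a+1)^k / Gamma(k a + 1).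

   For the derivatives, put x = (s / l) ^ a: the k-th derivative of
   s |-> 1 - expR (- x) is (-1)^(k+1) s^-k q_k(x) expR (- x) for polynomials q_k
   with q_(k+1) = k q_k + a x (q_k - q_k').  For 0 <= a <= 1 the coefficients of
   q_k are nonnegative and bounded independently of a, the leading one is a^k,
   and q_k(0) = 0.  Hence the lower bound, and the k-th derivative is dominated
   by C_k s^-k (1 - expR (- x)), which allows termwise differentiation. *)
Require Import Defs.
From HB Require Import structures.
From mathcomp Require Import all_boot all_order all_algebra finmap.
From mathcomp Require Import all_classical all_reals all_analysis.
From mathcomp Require Import measurable_realfun ring lra.
Set Implicit Arguments.
Unset Strict Implicit.
Unset Printing Implicit Defensive.
Import Order.TTheory GRing.Theory Num.Theory.
Import numFieldNormedType.Exports.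
Local Open Scope classical_set_scope.
Local Open Scope ring_scope.

(** * Derivatives of the Weibull distribution function *)

Section weibull_derivatives.
Context {R : realType}.
Implicit Types (a l s x : R) (p : {poly R}).

(* With x = (s / l) `^ a, the n.+1-st derivative of s |-> 1 - expR (- x) is
   (-1) ^+ n * (weibull_poly a n).[x] * expR (- x) / s ^+ n.+1. *)
Fixpoint weibull_poly a (n : nat) : {poly R} :=
  if n is m.+1 then
    m.+1%:R *: weibull_poly a m
      + a *: ('X * (weibull_poly a m - (weibull_poly a m)^`()))
  else a *: 'X.

Lemma coef_weibull_polyS a n j :
  (weibull_poly a n.+1)`_j.+1 =
    (n.+1%:R - a * j.+1%:R) * (weibull_poly a n)`_j.+1
      + a * (weibull_poly a n)`_j.
Proof.
rewrite /= coefD !coefZ coefXM/= coefB coef_deriv -mulr_natr; ring.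
Qed.

Lemma coef0_weibull_poly a n : (weibull_poly a n)`_0 = 0.
Proof.
elim: n => [|n ih]; first by rewrite /= coefZ coefX mulr0.
by rewrite /= coefD !coefZ coefXM/= ih !mulr0 addr0.
Qed.

Lemma coef_weibull_poly_gt a n j : (n.+1 < j)%N -> (weibull_poly a n)`_j = 0.
Proof.
elim: n j => [|n ih] [|j]// nj.
  by rewrite /= coefZ coefX; case: j nj => //= j _; rewrite mulr0.
by rewrite coef_weibull_polyS !ih ?mulr0 ?addr0//; exact: ltnW.
Qed.

Lemma lead_weibull_poly a n : (weibull_poly a n)`_n.+1 = a ^+ n.+1.
Proof.
elim: n => [|n ih]; first by rewrite /= coefZ coefX mulr1.
by rewrite coef_weibull_polyS coef_weibull_poly_gt// mulr0 add0r ih -exprS.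
Qed.

(** For j <= n the factor n.+1 - a * j.+1 in the recurrence lies between 0 and n.+1, so signs
    persist and the bound grows by a factor n.+2 at most; for j > n the coefficient it multiplies is
    zero. *)
Lemma coef_weibull_poly_bound a n j : 0 <= a <= 1 ->
  0 <= (weibull_poly a n)`_j <= n.+1`!%:R.
Proof.
move=> /andP[a0 a1]; elim: n j => [|n ih] j.
  rewrite /= coefZ coefX; case: (j == 1%N); last by rewrite mulr0 lexx ler01.
  by rewrite mulr1 a0 a1.
case: j => [|j]; first by rewrite coef0_weibull_poly lexx ler0n.
rewrite coef_weibull_polyS factS natrM.
have [nj|jn] := ltnP n j.
  rewrite coef_weibull_poly_gt// mulr0 add0r.
  have /andP[c0 c1] := ih j; rewrite mulr_ge0//=.
  rewrite (le_trans (ler_piMl c0 a1))// (le_trans c1)//.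
  by rewrite ler_peMl// ler1n.
have /andP[c0 c1] := ih j; have /andP[d0 d1] := ih j.+1.
have aj : a * j.+1%:R <= n.+1%:R.
  by rewrite (le_trans (ler_piMl _ a1))// ler_nat.
have aj0 : 0 <= a * j.+1%:R by rewrite mulr_ge0.
rewrite addr_ge0 ?mulr_ge0 ?subr_ge0//=.
rewrite -[n.+2%:R]natr1 [leRHS]mulrDl mul1r lerD//.
  by rewrite ler_pM ?subr_ge0// gerBl.
by rewrite (le_trans (ler_piMl c0 a1)).
Qed.

Lemma horner_weibull_poly a n x : (weibull_poly a n).[x] =
  \sum_(j < n.+2) (weibull_poly a n)`_j * x ^+ j.
Proof.
apply: horner_coef_wide; apply/leq_sizeP => j nj.
by rewrite coef_weibull_poly_gt.
Qed.

Lemma weibull_poly_ge a n x : 0 <= a <= 1 -> 0 <= x ->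
  a ^+ n.+1 * x ^+ n.+1 <= (weibull_poly a n).[x].
Proof.
move=> a01 x0; rewrite horner_weibull_poly big_ord_recr/= lead_weibull_poly.
rewrite lerDr sumr_ge0// => i _; rewrite mulr_ge0 ?exprn_ge0//.
by have /andP[] := coef_weibull_poly_bound n i a01.
Qed.

Lemma exprn_expRN_le x j : 0 <= x ->
  x ^+ j.+1 * expR (- x) <= j.+1`!%:R * (1 - expR (- x)).
Proof.
move=> x0; rewrite -(ler_pM2r (expR_gt0 x)) -!mulrA mulrBl mul1r.
rewrite [expR (- x) * _]mulrC expRxMexpNx_1 mulr1.
rewrite mulrC -ler_pdivrMr ?ltr0n ?fact_gt0// lerBrDl.
exact: expR_ge1Dxn.
Qed.

(** Coefficient bound times the constants of [exprn_expRN_le], summed over the monomials; being free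
    of the shape a, it serves all types at once. *)
Definition weibull_bound n : R :=
  n.+1`!%:R * \sum_(j < n.+1) j.+1`!%:R.

Lemma weibull_poly_le a n x : 0 <= a <= 1 -> 0 <= x ->
  (weibull_poly a n).[x] * expR (- x) <= weibull_bound n * (1 - expR (- x)).
Proof.
move=> a01 x0; rewrite horner_weibull_poly big_ord_recl/=.
(* Without constant term, every monomial left carries a positive power of x and falls under
   [exprn_expRN_le]. *)
rewrite coef0_weibull_poly mul0r add0r mulr_suml.
rewrite -mulrA mulr_suml mulr_sumr; apply: ler_sum => j _.
rewrite -mulrA ler_pM//.
- by have /andP[] := coef_weibull_poly_bound n (bump 0 j) a01.
- by rewrite mulr_ge0 ?exprn_ge0 ?expR_ge0.
- by have /andP[] := coef_weibull_poly_bound n (bump 0 j) a01.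
- exact: exprn_expRN_le.
Qed.

Definition weibull_hazard a l s : R := (s / l) `^ a.

Lemma weibull_hazard_ge0 a l s : 0 <= weibull_hazard a l s.
Proof. exact: powR_ge0. Qed.

Lemma is_derive_weibull_hazard a l s : 0 < l -> 0 < s ->
  is_derive s 1 (weibull_hazard a l) (a * weibull_hazard a l s / s).
Proof.
move=> l0 s0.
have sl0 : 0 < s / l by rewrite divr_gt0.
have -> : a * weibull_hazard a l s / s = (a * (s / l) `^ (a - 1)) * l^-1.
  rewrite powRB; last by apply/implyP => _; rewrite gt_eqF.
  rewrite powRr1 ?ltW// /weibull_hazard; field.
  by rewrite !gt_eqF.
have d1 : is_derive s 1 (fun r : R => r / l) l^-1.
  apply: trigger_derive.
  by rewrite /GRing.scale/= mulr0 add0r mulr1.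
have d2 := is_derive1_powR a sl0.
exact: (@is_derive1_comp R (fun y => y `^ a) (fun r => r / l) s _ _ d2 d1).
Qed.

Definition weibull_cdf a l s : R := 1 - expR (- weibull_hazard a l s).

Definition weibull_cdf_dn a l n s : R :=
  if n is m.+1 then
    (-1) ^+ m * ((weibull_poly a m).[weibull_hazard a l s]
      * expR (- weibull_hazard a l s)) / s ^+ n
  else weibull_cdf a l s.

Lemma is_derive_weibull_cdf_dn a l n s : 0 < l -> 0 < s ->
  is_derive s 1 (weibull_cdf_dn a l n) (weibull_cdf_dn a l n.+1 s).
Proof.
move=> l0 s0; have dh := is_derive_weibull_hazard a l0 s0.
set x := weibull_hazard a l s.
have dp p : is_derive s 1 (fun r => p.[weibull_hazard a l r])
    (p^`().[x] * (a * x / s)).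
  have := @is_derive1_comp R (horner p) (weibull_hazard a l) s _ _
    (is_derive_poly p x) dh.
  exact.
have de : is_derive s 1 (fun r => expR (- weibull_hazard a l r))
    (- (a * x / s) * expR (- x)).
  have dn : is_derive s 1 (fun r => - weibull_hazard a l r) (- (a * x / s)).
    exact: is_deriveN.
  rewrite mulrC.
  have := @is_derive1_comp R expR (fun r => - weibull_hazard a l r) s _ _
    (is_derive_expR (- x)) dn.
  exact.
case: n => [|n].
  rewrite /weibull_cdf_dn /weibull_cdf.
  apply: trigger_derive.
  rewrite /= expr0 expr1 -/x hornerZ hornerX; ring.
rewrite /weibull_cdf_dn.
have dsn : is_derive s 1 (fun r : R => r ^+ n.+1) (n.+1%:R * s ^+ n).
  have := @is_deriveX R R id n.+1 s 1 1 _.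
  by rewrite fctE /GRing.scale/= mulr1; apply; exact: is_derive_id.
have dV : is_derive s 1 (fun r : R => (r ^+ n.+1)^-1)
    (- (s ^+ n.+1) ^- 2 * (n.+1%:R * s ^+ n)).
  by apply: is_deriveV; rewrite gt_eqF// exprn_gt0.
apply: trigger_derive.
rewrite /GRing.scale/=.
(* What remains is the recursion of [weibull_poly]: the power of s contributes n.+1, the chain rule
   a * x / s. *)
rewrite -/x hornerD !hornerZ hornerM hornerX hornerD hornerN !exprS; field.
by rewrite expf_neq0// gt_eqF.
Qed.

Lemma weibull_hazard_le a l : 0 <= a -> 0 < l ->
  {in Num.nneg &, {homo weibull_hazard a l : s t / s <= t}}.
Proof.
move=> a0 l0 s t; rewrite !nnegrE => s0 t0 st.
apply: ge0_ler_powR; rewrite ?nnegrE ?divr_ge0 ?(ltW l0)//.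
by rewrite ler_pM2r// invr_gt0.
Qed.

Lemma weibull_cdf_ge0 a l s : 0 <= weibull_cdf a l s.
Proof. by rewrite subr_ge0 expR_le1 oppr_le0 weibull_hazard_ge0. Qed.

Lemma weibull_cdf_le a l : 0 <= a -> 0 < l ->
  {in Num.nneg &, {homo weibull_cdf a l : s t / s <= t}}.
Proof.
move=> a0 l0 s t s0 t0 st; rewrite lerD2l lerN2 ler_expR lerN2.
exact: weibull_hazard_le.
Qed.

Lemma weibull_cdf_dn_le a l n s : 0 <= a <= 1 -> 0 < s ->
  `|weibull_cdf_dn a l n.+1 s|
    <= weibull_bound n * weibull_cdf a l s / s ^+ n.+1.
Proof.
move=> a01 s0; rewrite /= !normrM normrX normrN1 expr1n mul1r.
rewrite (gtr0_norm (_ : 0 < (s ^+ n.+1)^-1)) ?invr_gt0 ?exprn_gt0//.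
rewrite ler_pM2r ?invr_gt0 -?exprS ?exprn_gt0//.
rewrite -normrM ger0_norm.
  exact: weibull_poly_le (weibull_hazard_ge0 _ _ _).
rewrite mulr_ge0 ?expR_ge0//.
apply: le_trans (weibull_poly_ge n a01 (weibull_hazard_ge0 a l s)).
by case/andP: a01 => a0 _; rewrite mulr_ge0 ?exprn_ge0 ?weibull_hazard_ge0.
Qed.

Lemma weibull_cdf_dn_ge a l n s : 0 <= a <= 1 -> 0 < s ->
  a ^+ n.+1 * (weibull_hazard a l s) ^+ n.+1 * expR (- weibull_hazard a l s) <=
  (-1) ^+ n.+2 * s ^+ n.+1 * weibull_cdf_dn a l n.+1 s.
Proof.
move=> a01 s0.
rewrite [leRHS](_ : _ = (weibull_poly a n).[weibull_hazard a l s]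
    * expR (- weibull_hazard a l s)).
  by rewrite ler_pM2r ?expR_gt0// weibull_poly_ge// weibull_hazard_ge0.
(* The signs (-1) ^+ n.+2 and (-1) ^+ n cancel, and so do the powers of s. *)
have := sqrr_sign R n; rewrite /= !exprS expr0 mulr1.
set e := (-1) ^+ n => e1; set p := _.[_]; set y := expR _.
transitivity (e * e * (p * y)); last by rewrite e1 mul1r.
by field; rewrite expf_neq0 gt_eqF.
Qed.

End weibull_derivatives.

Section sums.
Context {R : realType} {W : countType}.

(** Types are laid out along their codes, with 0 at naturals that code nothing; this opens sums over
    W to the theorems on integrals. *)
Lemma esum_counting (a : W -> \bar R) : (forall w, 0 <= a w)%E ->
  \esum_(w in [set: W]) a w =
    (\int[counting]_n oapp a 0 (@pickle_inv W n))%E.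
Proof.
move=> a0; rewrite ge0_integral_count; last by move=> n; case: pickle_inv.
rewrite nneseries_esumT; last by move=> n; case: pickle_inv => /=.
rewrite (esumID (range (@choice.pickle W)) [set: nat]); last first.
  by move=> n _; case: pickle_inv => /=.
rewrite !setTI [X in (_ + X)%E]esum1 ?adde0; last first.
  move=> n Hn; case E : (pickle_inv _) => [w|]//; exfalso; apply: Hn.
  exists w => //; by have := @pickle_invK W n; rewrite E.
rewrite esum_image; last by move=> x y _ _; exact: (pcan_inj choice.pickleK).
by apply: eq_esum => w _; rewrite pickleK_inv.
Qed.

End sums.

(** * Termwise differentiation of the mean number of types *)

Section weibull_mean_derivatives.
Context {R : realType} {W : countType}.
Variables (lam alpha : W -> R).
Hypothesis lam_gt0 : forall w, 0 < lam w.
Hypothesis alpha_gt0_le1 : forall w, 0 < alpha w /\ alpha w <= 1.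
Hypothesis mean_fin : forall s : R, 0 < s ->
  (\esum_(w in [set: W]) (weibull_cdf (alpha w) (lam w) s)%:E < +oo)%E.

Let alpha01 w : 0 <= alpha w <= 1.
Proof. by have [/ltW -> ->] := alpha_gt0_le1 w. Qed.

(** The index i is the code of a type, with value 0 if it codes none; differentiating the sum then
    means differentiating under the integral [F]. *)
Let f n s (i : nat) : R :=
  oapp (fun w => weibull_cdf_dn (alpha w) (lam w) n s) 0 (@pickle_inv W i).

Let F n s : R := \int[counting]_i f n s i.

Let f0_ge0 s i : 0 <= f 0 s i.
Proof. by rewrite /f; case: pickle_inv => //= w; exact: weibull_cdf_ge0. Qed.

Let esum_f0 s : \esum_(w in [set: W]) (weibull_cdf (alpha w) (lam w) s)%:E =
  (\int[counting]_i (f 0 s i)%:E)%E.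
Proof.
rewrite esum_counting; last by move=> w; rewrite lee_fin weibull_cdf_ge0.
by apply: eq_integral => i _; rewrite /f; case: pickle_inv.
Qed.

Let intf0 (s : R) : 0 < s -> counting.-integrable [set: nat] (EFin \o f 0 s).
Proof.
move=> s0; apply/integrableP; split => //.
have := mean_fin s0; rewrite esum_f0.
by under eq_integral => i _ do rewrite -[f 0 s i]ger0_norm ?f0_ge0//.
Qed.

(** For u <= s <= v the inverse power is largest at u and the distribution function at v, which
    makes the majorant independent of s. *)
Let f_le n (s u v : R) i : 0 < u -> u <= s -> s <= v ->
  `|f n.+1 s i| <= weibull_bound n / u ^+ n.+1 * f 0 v i.
Proof.
move=> u0 us sv; have s0 := lt_le_trans u0 us.
rewrite /f; case: pickle_inv => [w|]; last by rewrite /= normr0 mulr0.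
have [a0 _] := alpha_gt0_le1 w.
rewrite [leLHS]/= (le_trans (weibull_cdf_dn_le _ _ (alpha01 w) s0))//.
have B0 : 0 <= @weibull_bound R n.
  by rewrite mulr_ge0// sumr_ge0// => i' _; rewrite ler0n.
rewrite mulrAC ler_pM//=.
- by rewrite divr_ge0 ?exprn_ge0// ltW.
- exact: weibull_cdf_ge0.
- by rewrite ler_wpM2l// lef_pV2 ?posrE ?exprn_gt0// lerXn2r// nnegrE ltW.
- by apply: weibull_cdf_le; rewrite ?nnegrE ?(ltW a0)// ltW// (lt_le_trans s0).
Qed.

Let intf n (s : R) : 0 < s -> counting.-integrable [set: nat] (EFin \o f n s).
Proof.
case: n => [|n] s0; first exact: intf0.
apply: (@le_integrable _ _ _ _ _ _ _
  (EFin \o (fun i => weibull_bound n / s ^+ n.+1 * f 0 s i))) => //.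
  move=> i _; rewrite /= lee_fin (le_trans (f_le n i s0 (lexx _) (lexx _)))//.
  exact: ler_norm.
exact: (integrableZl measurableT _ (intf0 s0)).
Qed.

Let is_derive_F n (s : R) : 0 < s -> is_derive s 1 (F n) (F n.+1 s).
Proof.
(* The interval from s / 2 to 2 s is a neighbourhood of s that stays away from 0. *)
move=> s0; pose u := s / 2; pose v := s * 2.
have u0 : 0 < u by rewrite divr_gt0.
have us : u < s by rewrite ltr_pdivrMr// ltr_pMr// ltr1n.
have sv : s < v by rewrite ltr_pMr// ltr1n.
have v0 : 0 < v by rewrite (lt_trans s0).
have Is : `]u, v[%classic s by rewrite /= in_itv/= us sv.
have pos r : `]u, v[%classic r -> 0 < r.
  by rewrite /= in_itv/= => /andP[/(lt_trans u0)].
have der r i : `]u, v[%classic r -> is_derive r 1 ((f n) ^~ i) (f n.+1 r i).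
  move=> /pos r0; rewrite /f; case: pickle_inv => [w|]/=.
    exact: is_derive_weibull_cdf_dn.
  exact: is_derive_cst.
(* Majorant on the whole interval, integrable because the mean at v is finite. *)
pose G i := weibull_bound n / u ^+ n.+1 * f 0 v i.
have G0 i : 0 <= G i.
  have := f_le n i u0 (ltW us) (ltW sv).
  exact: le_trans.
have intG : counting.-integrable [set: nat] (EFin \o G).
  exact: (integrableZl measurableT _ (intf0 v0)).
have df r i : `]u, v[%classic r -> partial1of2 (f n) r i = f n.+1 r i.
  by move=> /der -/(_ i) d; rewrite partial1of2E derive_val.
have Gub r i : `]u, v[%classic r -> [set: nat] i ->
    `|partial1of2 (f n) r i| <= G i.
  move=> Ir _; rewrite df//.
  by move: Ir; rewrite /= in_itv/= => /andP[/ltW ? /ltW ?]; exact: f_le.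
have derf r i : `]u, v[%classic r -> [set: nat] i -> derivable ((f n) ^~ i) r 1.
  by move=> Ir _; have [] := der r i Ir.
have intfI r : `]u, v[%classic r ->
    counting.-integrable [set: nat] (EFin \o f n r).
  by move=> /pos; exact: intf.
apply: DeriveDef.
  exact: (@derivable_under_integral R _ nat counting (f n) setT measurableT
    s u v Is intfI derf G G0 intG Gub).
rewrite -derive1E.
rewrite (@differentiation_under_integral R _ nat counting (f n) setT measurableT
  s u v Is intfI derf G G0 intG Gub).
by apply: eq_Rintegral => i _; exact: df.
Qed.

Variable m : R -> R.
Hypothesis mE : forall s, 0 < s ->
  (m s)%:E = \esum_(w in [set: W]) (weibull_cdf (alpha w) (lam w) s)%:E.

Let derive1nF n (s : R) : 0 < s -> derive1n n m s = F n s.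
Proof.
elim: n s => [|n ih] s s0.
  rewrite derive1n0; apply: EFin_inj; rewrite mE// esum_f0.
  by rewrite /F /Rintegral fineK// (integrable_fin_num _ (intf0 s0)).
(* [m] is prescribed at positive times only; these form a neighbourhood of s, which determines the
   derivative. *)
rewrite derive1nS derive1E (@near_eq_derive _ _ _ _ (F n)) ?oner_eq0//.
  by have ? := is_derive_F n s0; rewrite derive_val.
by near=> r; apply: ih; near: r; exact: lt_nbhsr.
Unshelve. all: end_near. Qed.

Lemma derivable_weibull_mean n (s : R) : 0 < s -> derivable (derive1n n m) s 1.
Proof.
move=> s0; apply: (@near_eq_derivable _ _ _ (F n)) => //.
  by near=> r; apply/esym/derive1nF; near: r; exact: lt_nbhsr.
by have [] := is_derive_F n s0.
Unshelve. all: end_near. Qed.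

Lemma derive1n_weibull_mean_ge n (s : R) : 0 < s ->
  (\esum_(w in [set: W])
     (alpha w ^+ n.+1 * weibull_hazard (alpha w) (lam w) s ^+ n.+1
      * expR (- weibull_hazard (alpha w) (lam w) s))%:E
   <= ((-1) ^+ n.+2 * s ^+ n.+1 * derive1n n.+1 m s)%:E)%E.
Proof.
move=> s0; rewrite derive1nF// esum_counting; last first.
  move=> w; have /andP[a0 _] := alpha01 w.
  by rewrite lee_fin !mulr_ge0 ?exprn_ge0 ?expR_ge0 ?weibull_hazard_ge0.
(* The sign and the power of s go under the integral, where the comparison is made type by type. *)
rewrite /F -RintegralZl//; last exact: intf.
rewrite /Rintegral fineK; last first.
  exact/integrable_fin_num/(integrableZl measurableT _ (intf n.+1 s0)).
apply: ge0_le_integral => //.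
- move=> i _; case: pickle_inv => //= w; have /andP[a0 _] := alpha01 w.
  by rewrite lee_fin !mulr_ge0 ?exprn_ge0 ?expR_ge0 ?weibull_hazard_ge0.
- move=> i _; rewrite /f; case: pickle_inv => [w|] /=; last by rewrite mulr0.
  by rewrite lee_fin; exact: weibull_cdf_dn_ge.
Qed.

End weibull_mean_derivatives.

(** * Euler's Beta and Gamma integrals *)

Definition image_measure d1 d2 (T1 : measurableType d1)
    (T2 : measurableType d2) (R : realType) (m : {measure set T1 -> \bar R})
    (f : T1 -> T2) (mf : measurable_fun [set: T1] f) :
  {measure set T2 -> \bar R}.
Proof. by refine (pushforward m f : measure T2 R). Defined.

Section affine.
Context {R : realType}.
Local Notation mu := (@lebesgue_measure R).

Lemma measurable_affine (c b : R) :
  measurable_fun [set: measurableTypeR R]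
    (fun x : measurableTypeR R => c * x + b : measurableTypeR R).
Proof. by apply: measurable_funD => //; exact: measurable_funM. Qed.

(** Uniqueness of Lebesgue measure reduces this to half-open intervals, whose preimages are
    intervals shorter by the factor c. *)
Lemma lebesgue_measure_affine (c b : R) (c0 : 0 < c)
    (A : set (measurableTypeR R)) :
  measurable A ->
  mu A = (c%:E * mu ((fun x => (c * x + b)%R) @^-1` A))%E.
Proof.
move=> mA.
pose p : {measure set (measurableTypeR R) -> \bar R} :=
   image_measure mu (measurable_affine c b).
pose k : {nonneg R} := NngNum (ltW c0).
apply: (@lebesgue_measure_unique R (mscale k p)) => //= _ [[x y]] _ <-.
rewrite /mscale/= /pushforward.
rewrite (_ : _ @^-1` _ = `](x - b) / c, (y - b) / c]%classic).
  rewrite !lebesgue_measure_itv/= !lte_fin ltr_pM2r ?invr_gt0// ltrD2r.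
  case: ifPn => _; last by rewrite mule0.
  rewrite -EFinM; congr EFin; field; by rewrite gt_eqF.
apply/seteqP; split => z; rewrite /= !in_itv/= ltr_pdivrMr// ler_pdivlMr//;
  by rewrite ltrBlDr lerBrDr mulrC.
Qed.

Lemma ge0_integral_affine (c b : R) (f : R -> \bar R) : 0 < c ->
  measurable_fun [set: R] f -> (forall x, 0 <= f x)%E ->
  (\int[mu]_x f x = c%:E * \int[mu]_x f (c * x + b)%R)%E.
Proof.
move=> c0 mf f0.
pose p : {measure set (measurableTypeR R) -> \bar R} :=
   image_measure mu (measurable_affine c b).
pose k : {nonneg R} := NngNum (ltW c0).
transitivity (\int[mscale k p]_x f x)%E.
  apply: eq_measure_integral => A mA _.
  exact: lebesgue_measure_affine.
rewrite ge0_integral_mscale//=; congr (_ * _)%E.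
by rewrite (ge0_integral_pushforward (measurable_affine c b))//.
Qed.

End affine.

Ltac measurability :=
  repeat lazymatch goal with
  | |- measurable_fun _ (fun x => if _ then _ else _) =>
      apply: measurable_fun_ifT
  | |- measurable_fun _ (fun x => _ && _) => apply: measurable_and
  | |- measurable_fun _ (fun x => _ < _) => apply: measurable_fun_ltr
  | |- measurable_fun _ (fun x => _ <= _) => apply: measurable_fun_ler
  | |- measurable_fun _ (fun x => _ + - _) => apply: measurable_funB
  | |- measurable_fun _ (fun x => _ + _) => apply: measurable_funD
  | |- measurable_fun _ (fun x => _ * _) => apply: measurable_funM
  | |- measurable_fun _ (fun x => - _) => apply: measurable_funN
  | |- measurable_fun _ (fun x => expR _) =>
      apply: (measurableT_comp (@measurable_expR _))
  | |- measurable_fun _ (fun x => powR _ _) =>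
      apply: (measurableT_comp (@measurable_powR _ _))
  | |- _ => first [by [] | exact: measurable_fst | exact: measurable_snd
      | apply: measurable_fun_ler | apply: measurable_fun_ltr
      | apply: measurable_expR | apply: measurable_powR]
  end.

Section euler_beta_gamma.
Context {R : realType}.
Local Notation mu := (@lebesgue_measure R).
Implicit Types a x s u v : R.

(** Integrand of Gamma(x + 1), extended by 0 to the line. *)
Definition gamma_density x s : R := if 0 <= s then s `^ x * expR (- s) else 0.

Definition beta_density a x v : R :=
  if (0 < v) && (v `^ a^-1 <= 1) then (1 - v `^ a^-1) `^ x else 0.

Definition stretched_exp a u : R := if 0 < u then expR (- (u `^ a^-1)) else 0.

(* Its integral over R * R is computed by scaling in the second variable and by
   translation in the first; equating both gives the Beta-Gamma identity. *)
Definition beta_gamma_kernel a x (p : R * R) : R :=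
  if (0 < p.2) && (p.2 `^ a^-1 <= p.1)
  then (p.1 - p.2 `^ a^-1) `^ x * expR (- p.1) else 0.

Lemma powR_le1 (r v : R) : 0 < r -> 0 <= v -> (v `^ r <= 1) = (v <= 1).
Proof.
move=> r0 v0; have one : 1 `^ r = 1 :> R by rewrite powR1.
rewrite -[X in _ `^ _ <= X]one; have [v1|v1] := leP v 1.
  by apply: ge0_ler_powR; rewrite ?nnegrE// ltW.
by apply/negbTE; rewrite -ltNge; apply: gt0_ltr_powR; rewrite ?nnegrE.
Qed.

Lemma measurable_gamma_density x : measurable_fun [set: R] (gamma_density x).
Proof. by rewrite /gamma_density; measurability. Qed.

Lemma measurable_beta_density a x : measurable_fun [set: R] (beta_density a x).
Proof. by rewrite /beta_density; measurability. Qed.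

Lemma measurable_stretched_exp a : measurable_fun [set: R] (stretched_exp a).
Proof. by rewrite /stretched_exp; measurability. Qed.

Lemma measurable_beta_gamma_kernel a x :
  measurable_fun [set: R * R] (beta_gamma_kernel a x).
Proof. by rewrite /beta_gamma_kernel; measurability. Qed.

Lemma gamma_density_ge0 x s : 0 <= gamma_density x s.
Proof.
rewrite /gamma_density; case: ifP => // _.
by rewrite mulr_ge0 ?powR_ge0 ?expR_ge0.
Qed.

Lemma beta_density_ge0 a x s : 0 <= beta_density a x s.
Proof. by rewrite /beta_density; case: ifP => // _; rewrite powR_ge0. Qed.

Lemma stretched_exp_ge0 a s : 0 <= stretched_exp a s.
Proof. by rewrite /stretched_exp; case: ifP => // _; rewrite expR_ge0. Qed.

Lemma beta_gamma_kernel_ge0 a x p : 0 <= beta_gamma_kernel a x p.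
Proof.
rewrite /beta_gamma_kernel; case: ifP => // _.
by rewrite mulr_ge0 ?powR_ge0 ?expR_ge0.
Qed.

(** For u = s [^ a * v one has u]^ a^-1 = s * v [^ a^-1, so s factors out of the difference and the
    variables separate; the Jacobian s]^ a raises the exponent x to x + a. *)
Lemma beta_gamma_kernel_scale a x s v : 0 < a -> 0 < s ->
  s `^ a * beta_gamma_kernel a x (s, s `^ a * v + 0) =
  beta_density a x v * gamma_density (x + a) s.
Proof.
move=> a0 s0; rewrite /beta_gamma_kernel /beta_density /gamma_density /= addr0.
rewrite (ltW s0) pmulr_rgt0 ?powR_gt0//.
have [v0|] := ltP 0 v; last by rewrite /= mulr0 mul0r.
rewrite powRM ?powR_ge0 ?(ltW v0)// -powRrM divff ?gt_eqF// powRr1 ?(ltW s0)//=.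
rewrite -[X in _ <= X]mulr1 ler_pM2l//.
case: ifP => [v1|_]; last by rewrite mulr0 mul0r.
rewrite -[X in (X - _) `^ _]mulr1 -mulrBr powRM ?subr_ge0 ?(ltW s0)//.
rewrite powRD; last by apply/implyP => _; rewrite gt_eqF.
ring.
Qed.

Lemma beta_gamma_kernel_shift a x s u : 
  beta_gamma_kernel a x (1 * s + u `^ a^-1, u) =
  gamma_density x s * stretched_exp a u.
Proof.
rewrite /beta_gamma_kernel /gamma_density /stretched_exp /= mul1r.
case: ifP => [/andP[u0 us]|]; last case: ltP => //=; last by rewrite mulr0.
  by rewrite u0 -(lerD2r (u `^ a^-1)) add0r us addrK opprD expRD; ring.
move=> _ /negbT; rewrite -{1}[u `^ a^-1]add0r lerD2r => /negbTE ->.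
by rewrite mul0r.
Qed.

Local Open Scope ereal_scope.

Lemma beta_gamma_tonelli a x : (0 < a)%R -> (0 <= x)%R ->
  (\int[mu]_v (beta_density a x v)%:E)
    * (\int[mu]_s (gamma_density (x + a) s)%:E) =
  (\int[mu]_s (gamma_density x s)%:E) * (\int[mu]_u (stretched_exp a u)%:E).
Proof.
move=> a0 x0.
pose f (p : R * R) := (beta_gamma_kernel a x p)%:E.
have mf : measurable_fun [set: R * R] f.
  by apply/measurable_EFinP; exact: measurable_beta_gamma_kernel.
have f0 p : 0 <= f p by rewrite lee_fin beta_gamma_kernel_ge0.
have mf1 s : measurable_fun [set: R] (fun u => f (s, u)).
  by apply: (measurableT_comp mf); exact: measurable_pair1.
have mf2 u : measurable_fun [set: R] (fun s => f (s, u)).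
  by apply: (measurableT_comp mf); exact: measurable_pair2.
have mg y : measurable_fun [set: R] (fun s => (gamma_density y s)%:E).
  by apply/measurable_EFinP; exact: measurable_gamma_density.
have mb : measurable_fun [set: R] (fun s => (beta_density a x s)%:E).
  by apply/measurable_EFinP; exact: measurable_beta_density.
have me : measurable_fun [set: R] (fun s => (stretched_exp a s)%:E).
  by apply/measurable_EFinP; exact: measurable_stretched_exp.
have := @fubini_tonelli _ _ (measurableTypeR R) (measurableTypeR R) R
  mu mu f mf f0.
have -> : \int[mu]_s \int[mu]_u f (s, u) =
    \int[mu]_s ((\int[mu]_v (beta_density a x v)%:E)
      * (gamma_density (x + a) s)%:E).
  apply: eq_integral => s _.
  have [s0|s0] := ltP 0%R s; last first.
    rewrite integral0_eq; last first.
      move=> u _; rewrite /f /beta_gamma_kernel /=; case: ltP => //= u0.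
      by rewrite leNgt (le_lt_trans s0) ?powR_gt0.
    (* At s = 0 the density vanishes because x + a > 0. *)
    rewrite /gamma_density; move: s0; rewrite le_eqVlt => /orP[/eqP ->|s0].
      by rewrite lexx powR0 ?mul0r ?mule0// gt_eqF// ltr_wpDl.
    by rewrite leNgt s0 mule0.
  rewrite (@ge0_integral_affine _ (s `^ a) 0)//; last by rewrite powR_gt0.
  have mfs : measurable_fun [set: R] (fun v => f (s, (s `^ a * v + 0)%R)).
    by apply: (measurableT_comp (mf1 s)); exact: measurable_affine.
  rewrite -ge0_integralZl//; last by rewrite lee_fin powR_ge0.
  rewrite -ge0_integralZr//; last by rewrite lee_fin gamma_density_ge0.
    by apply: eq_integral => v _; rewrite /f -!EFinM beta_gamma_kernel_scale.
  by move=> v _; rewrite lee_fin beta_density_ge0.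
have -> : \int[mu]_u \int[mu]_s f (s, u) =
    \int[mu]_u ((\int[mu]_s (gamma_density x s)%:E) * (stretched_exp a u)%:E).
  apply: eq_integral => u _.
  rewrite (@ge0_integral_affine _ 1 (u `^ a^-1))//.
  rewrite mul1e -ge0_integralZr//; last by rewrite lee_fin stretched_exp_ge0.
    by apply: eq_integral => s _; rewrite /f beta_gamma_kernel_shift EFinM.
  - exact: mg.
  - by move=> s _; rewrite lee_fin gamma_density_ge0.
rewrite ge0_integralZl//; last 3 first.
- exact: mg.
- by move=> s _; rewrite lee_fin gamma_density_ge0.
- by apply: integral_ge0 => s _; rewrite lee_fin beta_density_ge0.
rewrite ge0_integralZl//; last 2 first.
- by move=> u _; rewrite lee_fin stretched_exp_ge0.
- by apply: integral_ge0 => s _; rewrite lee_fin gamma_density_ge0.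
Qed.

Lemma gamma_integral0 : \int[mu]_s (gamma_density 0 s)%:E = 1.
Proof.
rewrite -(@integral_exponential_pdf R 1)//; apply: eq_integral => s _.
rewrite /gamma_density /exponential_pdf patchE mem_setE in_itv/= andbT.
by case: ifP => // _; rewrite powRr0 !mul1r mulN1r.
Qed.

Lemma beta_integral0 a : (0 < a)%R -> \int[mu]_v (beta_density a 0 v)%:E = 1.
Proof.
move=> a0; transitivity (\int[mu]_v (\1_[set` `]0%R, 1%R]] v)%:E).
  apply: eq_integral => v _.
  rewrite /beta_density powRr0 indicE mem_setE in_itv/=.
  have [v0|v0] := ltP 0%R v => //=.
  by rewrite powR_le1 ?invr_gt0 ?(ltW v0)//; case: (v <= 1)%R.
rewrite integral_indic//= setIT lebesgue_measure_itv/= lte_fin ltr01.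
by rewrite sube0.
Qed.

(** The Beta-Gamma identity at x = 0, where two of its four integrals equal 1, replaces a nonlinear
    change of variables. *)
Lemma stretched_exp_integral a : (0 < a)%R ->
  \int[mu]_u (stretched_exp a u)%:E = \int[mu]_s (gamma_density a s)%:E.
Proof.
move=> a0; have := beta_gamma_tonelli a0 (lexx 0%R).
by rewrite beta_integral0// gamma_integral0 !mul1e add0r.
Qed.

Lemma gamma_integral_fin x : (0 <= x)%R ->
  \int[mu]_s (gamma_density x s)%:E < +oo.
Proof.
move=> x0; pose n := Num.truncn x.
have xn : (x <= n.+1%:R)%R by rewrite ltW// truncnS_gt.
pose C : R := (1 + n.+1`!%:R * 2 ^+ n.+1)%R.
have C0 : (0 <= C)%R by rewrite addr_ge0// mulr_ge0.
have C2 : (0 <= C * 2)%R by rewrite mulr_ge0.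
apply: (@le_lt_trans _ _
  (\int[mu]_s ((C * 2)%:E * (exponential_pdf 2^-1 s)%:E))).
  apply: ge0_le_integral => //=.
  - by move=> s _; rewrite lee_fin gamma_density_ge0.
  - by apply/measurable_EFinP; exact: measurable_gamma_density.
  - apply: emeasurable_funM => //.
    by apply/measurable_EFinP; exact: measurable_exponential_pdf.
  move=> s _; rewrite -EFinM lee_fin /gamma_density /exponential_pdf patchE.
  rewrite mem_setE in_itv/= andbT; case: ifP => s0; last by rewrite mulr0.
  rewrite mulrA mulfK//.
  have -> : expR (- s) = (expR (- (s / 2)) * expR (- (s / 2)))%R.
    by rewrite -expRD; congr expR; lra.
  rewrite mulrA mulNr [(2^-1 * s)%R]mulrC ler_pM2r ?expR_gt0//.
  rewrite expRN -ler_pdivlMr ?invr_gt0 ?expR_gt0// invrK.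
  have s2 : (0 <= s / 2)%R by rewrite divr_ge0.
  have e1 : (1 <= expR (s / 2))%R.
    by apply: le_trans (expR_ge1Dx _); rewrite lerDl.
  have [s1|s1] := leP s 1%R.
    have p1 : (s `^ x <= 1)%R.
      have one : (1 `^ x = 1 :> R)%R by rewrite powR1.
      by rewrite -[leRHS]one; apply: ge0_ler_powR; rewrite ?nnegrE.
    apply: (le_trans p1); rewrite -[leLHS]mulr1 ler_pM//.
    by rewrite lerDl mulr_ge0.
  have p1 : (s `^ x <= s ^+ n.+1)%R.
    by rewrite -powR_mulrn//; apply: ler_powR => //; exact: ltW.
  apply: (le_trans p1).
  have := expR_ge1Dxn n s2.
  rewrite expr_div_n => h.
  have {}h : (s ^+ n.+1 / 2 ^+ n.+1 / n.+1`!%:R <= expR (s / 2))%R.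
    by apply: le_trans h; rewrite lerDr.
  move: h; rewrite ler_pdivrMr ?ltr0n ?fact_gt0// ler_pdivrMr ?exprn_gt0//.
  move=> h; apply: (le_trans h).
  rewrite -mulrA mulrC ler_wpM2r ?expR_ge0//.
  by rewrite /C lerDr.
rewrite ge0_integralZl//=.
- by rewrite integral_exponential_pdf// mule1 ltry.
- by apply/measurable_EFinP; exact: measurable_exponential_pdf.
- by move=> s _; rewrite lee_fin exponential_pdf_ge0.
Qed.

Lemma gamma_integral_gt0 x : (0 <= x)%R ->
  0 < \int[mu]_s (gamma_density x s)%:E.
Proof.
move=> x0.
apply: (@lt_le_trans _ _
  (\int[mu]_s ((expR (- 2))%:E * (\1_[set` `]1%R, 2%R]] s)%:E))).
  rewrite ge0_integralZl//=.
  - rewrite integral_indic//= setIT lebesgue_measure_itv/= lte_fin ltr1n.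
    by rewrite -EFinB mule_gt0// lte_fin ?expR_gt0// subr_gt0 ltr1n.
  - by apply/measurable_EFinP.
apply: ge0_le_integral => //=.
- by apply: emeasurable_funM => //; apply/measurable_EFinP.
- by apply/measurable_EFinP; exact: measurable_gamma_density.
move=> s _; rewrite -EFinM lee_fin indicE mem_setE in_itv/=.
have [/andP[s1 s2]|_] := boolP (1 < s <= 2)%R; last first.
  by rewrite mulr0 gamma_density_ge0.
rewrite mulr1 /gamma_density (le_trans ler01 (ltW s1)).
rewrite -[leLHS]mul1r ler_pM ?expR_ge0 ?ler_expR ?lerN2//.
by rewrite -(powRr0 s); apply: ler_powR => //; exact: ltW.
Qed.

(** Finiteness of the integral excludes the default value in [euler_gamma], and the endpoint 0 is a
    null set. *)
Lemma euler_gammaE x : 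
  (0 <= x)%R -> (euler_gamma (x + 1))%:E = \int[mu]_s (gamma_density x s)%:E.
Proof.
move=> x0; rewrite /euler_gamma addrK /Rintegral.
rewrite (@integral_itv_obnd_cbnd _ _ _
  (fun s => (s `^ x * expR (- s))%:E)); last first.
  apply: measurable_funTS; apply/measurable_EFinP.
  by measurability.
rewrite [X in (fine X)%:E](_ : _ =
    \int[mu]_s (gamma_density x s)%:E); last first.
  rewrite integral_mkcond; apply: eq_integral => s _.
  rewrite /gamma_density patchE mem_setE in_itv/= andbT.
  by case: ifP.
rewrite fineK// ge0_fin_numE ?gamma_integral_fin//.
by apply: integral_ge0 => s _; rewrite lee_fin gamma_density_ge0.
Qed.

#[local] Opaque euler_gamma.

Lemma euler_gamma_gt0 x : (0 <= x)%R -> (0 < euler_gamma (x + 1))%R.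
Proof. by move=> x0; rewrite -lte_fin euler_gammaE// gamma_integral_gt0. Qed.

Lemma euler_gamma1 : @euler_gamma R 1 = 1%R.
Proof.
by apply: EFin_inj; rewrite -[1%R in LHS]add0r euler_gammaE// gamma_integral0.
Qed.

Lemma beta_integralE a x : (0 < a)%R -> (0 <= x)%R ->
  \int[mu]_v (beta_density a x v)%:E =
  (euler_gamma (x + 1) * euler_gamma (a + 1) / euler_gamma (x + a + 1))%:E.
Proof.
move=> a0 x0; have xa0 : (0 <= x + a)%R by rewrite addr_ge0// ltW.
have := beta_gamma_tonelli a0 x0.
rewrite (stretched_exp_integral a0).
rewrite -(euler_gammaE x0) -(euler_gammaE (ltW a0)) -(euler_gammaE xa0).
have g0 := euler_gamma_gt0 xa0.
(* The Beta integral is not yet known to be finite; its product with a positive number is, which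
   excludes infinite values. *)
case: (integral _ _ _) => [r| |].
- rewrite -!EFinM => -[rE]; congr EFin.
  by rewrite -rE mulfK// gt_eqF.
- by rewrite gt0_mulye ?lte_fin.
- by rewrite gt0_mulNye ?lte_fin.
Qed.

End euler_beta_gamma.

(** * The Weibull law *)

Section distribution_of_cdf.
Context {R : realType}.

(** The rays to the right are closed under intersection and generate the Borel sets; on them the
    measures agree by taking complements. *)
Lemma probability_unique_cdf (m1 m2 : probability R R) :
  (forall y : R, m1 `]-oo, y]%classic = m2 `]-oo, y]%classic) ->
  forall A, measurable A -> m1 A = m2 A.
Proof.
move=> m12 A mA.
have tail (m : probability R R) x :
    m `]x, +oo[%classic = (1 - m `]-oo, x]%classic)%E.
  rewrite -setCitvl; apply: (@probability_setC _ R R m).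
  exact: measurable_itv.
apply: (@measure_unique _ R R (@RGenOInfty.G R)
  (fun n => `](- n%:R)%R, +oo[%classic) _ _ _ _ m1 m2) => //.
- exact: RGenOInfty.measurableE.
- move=> _ _ [x ->] [y ->]; exists (Num.max x y).
  by apply/seteqP; split => z; rewrite /= !in_itv/= !andbT gt_max => /andP.
- by move=> n; exists (- n%:R).
- apply/seteqP; split => // x _; exists (Num.bound `|x|) => //=.
  rewrite in_itv/= andbT ltrNl (le_lt_trans _ (archi_boundP (normr_ge0 x)))//.
  by rewrite ler_normr lexx orbT.
- by move=> _ [x ->]; have := tail m1 x; rewrite m12 -tail.
- by move=> k; rewrite (le_lt_trans (probability_le1 _ _))// ltry.
Qed.

Lemma eq_cdf_distribution d1 d2
    (T1 : measurableType d1) (T2 : measurableType d2)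
    (P1 : probability T1 R) (P2 : probability T2 R)
    (X1 : {RV P1 >-> R}) (X2 : {RV P2 >-> R}) :
  cdf X1 =1 cdf X2 ->
  forall A, measurable A -> distribution P1 X1 A = distribution P2 X2 A.
Proof.
move=> X12 A mA.
exact: (@probability_unique_cdf (distribution P1 X1) (distribution P2 X2)).
Qed.

End distribution_of_cdf.

Section exponential.
Context {R : realType}.
Local Notation mu := (@lebesgue_measure R).

Definition exp1 : probability (measurableTypeR R) R.
Proof. by refine (exponential_prob 1 : probability _ R). Defined.

Lemma exp1E (A : set R) :
  exp1 A = (\int[mu]_(x in A) (exponential_pdf 1 x)%:E)%E.
Proof. by []. Qed.

Lemma exp1_dom : exp1 `<< mu.
Proof.
apply/null_content_dominatesP => A mA A0.
rewrite exp1E; apply: null_set_integral => //.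
apply: measurable_funTS; apply/measurable_EFinP.
exact: measurable_exponential_pdf.
Qed.

Local Open Scope ereal_scope.

Lemma ge0_integral_exp1 (f : R -> \bar R) :
  measurable_fun [set: R] f -> (forall x, 0 <= f x) ->
  \int[exp1]_x f x = \int[mu]_(x in `]0%R, +oo[) (f x * (expR (- x))%:E).
Proof.
move=> mf f0.
have mpdf : measurable_fun [set: measurableTypeR R]
    (fun x => (exponential_pdf (1 : R) x)%:E).
  by apply/measurable_EFinP; exact: measurable_exponential_pdf.
rewrite -(Radon_Nikodym_SigmaFinite.change_of_variables exp1_dom)//.
transitivity (\int[mu]_x (f x * (exponential_pdf 1 x)%:E)).
  apply: ae_eq_integral => //.
  - apply: emeasurable_funM => //.
    exact: (measurable_int _ (Radon_Nikodym_SigmaFinite.f_integrable exp1_dom)).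
  - exact: emeasurable_funM.
  (* The Radon-Nikodym derivative is almost everywhere the density, since both integrate to [exp1 E]
     over each measurable [E]. *)
  - apply: ae_eqe_mul2l; apply: integral_ae_eq => //.
      exact: Radon_Nikodym_SigmaFinite.f_integrable exp1_dom.
    move=> E _ mE; rewrite -Radon_Nikodym_SigmaFinite.f_integral//.
    exact: exp1_dom.
rewrite integral_itv_obnd_cbnd; last first.
  apply: measurable_funTS; apply: emeasurable_funM => //.
  by apply/measurable_EFinP; measurability.
rewrite [RHS]integral_mkcond; apply: eq_integral => x _.
rewrite /exponential_pdf !patchE; case: ifP => _; last by rewrite mule0.
by rewrite mul1r mulN1r.
Qed.

Lemma exp1_itvcc (c : R) : (0 <= c)%R ->
  exp1 `[0%R, c]%classic = (1 - expR (- c))%:E.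
Proof.
rewrite le_eqVlt => /orP[/eqP <-|c0]; last first.
  by rewrite /exp1/= exponential_prob_itv0c// mulN1r.
rewrite set_itv1 oppr0 expR0 subrr exp1E.
by rewrite integral_set1.
Qed.

Lemma exp1_itvNyc (c : R) : (0 <= c)%R ->
  exp1 `]-oo, c]%classic = (1 - expR (- c))%:E.
Proof.
move=> c0; rewrite -exp1_itvcc// !exp1E.
rewrite integral_mkcond [RHS]integral_mkcond; apply: eq_integral => x _.
rewrite !patchE !mem_setE !in_itv/=; case: (leP 0%R x) => //= x0.
by rewrite lt0_exponential_pdf// if_same.
Qed.

End exponential.

#[local] Opaque euler_gamma.

Section weibull_law.
Context {R : realType}.
Local Notation mu := (@lebesgue_measure R).
Variables a l : R.
Hypotheses (a0 : 0 < a) (l0 : 0 < l).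

(** Inverse of the hazard, hence the Weibull quantile at level 1 - expR (- u) rather than at level
    u; it carries [exp1] to the Weibull law. *)
Definition weibull_quantile (u : measurableTypeR R) : R := l * u `^ a^-1.

Lemma measurable_weibull_quantile :
  measurable_fun [set: measurableTypeR R] weibull_quantile.
Proof. by rewrite /weibull_quantile; measurability. Qed.

HB.instance Definition _ := isMeasurableFun.Build _ _ _ _ weibull_quantile
  measurable_weibull_quantile.

Lemma weibull_quantile_le (u y : R) : 0 <= u -> 0 <= y ->
  (weibull_quantile u <= y) = (u <= weibull_hazard a l y).
Proof.
move=> u0 y0; rewrite /weibull_quantile /weibull_hazard.
have yl : 0 <= y / l by rewrite divr_ge0// ltW.
rewrite mulrC -ler_pdivlMr//.
rewrite -[in RHS](powRr1 u0) -(mulVf (lt0r_neq0 a0)) powRrM.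
rewrite !leNgt; congr negb; apply/idP/idP.
  by apply: gt0_ltr_powR; rewrite ?nnegrE ?powR_ge0.
apply: contraTT; rewrite -!leNgt; apply: ge0_ler_powR;
  by rewrite ?nnegrE ?powR_ge0// ltW.
Qed.

Context d (T : measurableType d) (P : probability T R) (X : {RV P >-> R}).
Hypothesis X_gt0 : forall x, 0 < X x.
Hypothesis cdfX : forall y, 0 <= y -> cdf X y = (weibull_cdf a l y)%:E.

Let cdf_weibull_quantile : cdf X =1 cdf (weibull_quantile : {RV exp1 >-> R}).
Proof.
move=> y; have [y0|y0] := leP 0 y; last first.
  rewrite /cdf /distribution /pushforward.
  rewrite (_ : _ @^-1` _ = set0) ?measure0; last first.
    apply/seteqP; split => // x /=; rewrite in_itv/=.
    by move=> /(lt_le_trans (X_gt0 x)) /lt_trans /(_ y0); rewrite ltxx.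
  rewrite (_ : _ @^-1` _ = set0) ?measure0//.
  apply/seteqP; split => // x /=; rewrite in_itv/= => xy.
  have := le_lt_trans xy y0.
  by rewrite ltNge mulr_ge0 ?powR_ge0// ltW.
rewrite cdfX// -exp1_itvNyc ?weibull_hazard_ge0//.
rewrite /cdf /distribution /pushforward.
rewrite !exp1E integral_mkcond [RHS]integral_mkcond; apply: eq_integral => u _.
rewrite !patchE !mem_setE !in_itv/=.
(* The two events are compared for u >= 0 only; for u < 0 the exponential density is zero. *)
have [u0|u0] := leP 0 u; last by rewrite lt0_exponential_pdf// !if_same.
rewrite -weibull_quantile_le//; congr (if _ then _ else _).
Qed.

Lemma ge0_expectation_weibull (g : R -> \bar R) :
  measurable_fun [set: R] g -> (forall x, 0 <= g x)%E ->
  (\int[P]_x g (X x) =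
   \int[mu]_(u in `]0%R, +oo[) (g (weibull_quantile u) * (expR (- u))%:E))%E.
Proof.
move=> mg g0.
rewrite -(ge0_integral_exp1 (f := g \o weibull_quantile)); first last.
- by move=> u; exact: g0.
- by apply: (measurableT_comp mg); exact: measurable_weibull_quantile.
rewrite -(ge0_integral_distribution X mg)//.
rewrite -(ge0_integral_distribution (weibull_quantile : {RV exp1 >-> R}) mg)//.
apply: eq_measure_integral => A mA _.
exact: (eq_cdf_distribution cdf_weibull_quantile).
Qed.

(** At b = 0 and t >= 0 this is the probability that a waiting time exceeds t; each conditioning on
    a waiting time raises b by a. *)
Definition weibull_kernel b t : R :=
  if 0 <= t then (t / l) `^ b * expR (- weibull_hazard a l t) else 0.

Lemma weibull_kernel_ge0 b t : 0 <= weibull_kernel b t.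
Proof.
rewrite /weibull_kernel; case: ifP => // _.
by rewrite mulr_ge0 ?powR_ge0 ?expR_ge0.
Qed.

Lemma measurable_weibull_kernel b : measurable_fun [set: R] (weibull_kernel b).
Proof. by rewrite /weibull_kernel /weibull_hazard; measurability. Qed.

Hypothesis a1 : a <= 1.

Lemma weibull_kernel_quantile_le b t v : 0 < t -> 0 < v ->
  weibull_kernel b (t - weibull_quantile (weibull_hazard a l t * v))
    * expR (- (weibull_hazard a l t * v)) <=
  (t / l) `^ b * expR (- weibull_hazard a l t) * beta_density a b v.
Proof.
move=> t0 v0; set c := weibull_hazard a l t.
have tl0 : 0 < t / l by rewrite divr_gt0.
have c0 : 0 < c by rewrite powR_gt0.
set w := v `^ a^-1.
have w0 : 0 < w by rewrite powR_gt0.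
have vE : v = w `^ a by rewrite -powRrM mulVf ?gt_eqF// powRr1// ltW.
have -> : weibull_quantile (c * v) = t * w.
  rewrite /weibull_quantile powRM ?(ltW v0) ?(ltW c0)//.
  rewrite -powRrM divff ?gt_eqF// powRr1 ?(ltW tl0)// -/w; field.
  by rewrite gt_eqF.
have -> : t - t * w = t * (1 - w) by ring.
rewrite /weibull_kernel /beta_density v0 -/w /= pmulr_rge0// subr_ge0.
case: ifP => [w1|_]; last by rewrite mul0r mulr0.
have w1' : 0 <= 1 - w by rewrite subr_ge0.
have hE : weibull_hazard a l (t * (1 - w)) = c * (1 - w) `^ a.
  by rewrite /weibull_hazard mulrAC powRM// ltW.
rewrite hE mulrAC [t * _ / l]mulrAC powRM ?(ltW tl0)//.
rewrite -!mulrA ler_wpM2l ?powR_ge0// mulrC ler_wpM2r ?powR_ge0//.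
rewrite -expRD ler_expR -opprD lerN2 -mulrDr ler_peMr ?(ltW c0)//.
(* Applied to w and to 1 - w, whose sum is 1, this yields the subadditivity. *)
have p1 z : 0 <= z -> z <= 1 -> z <= z `^ a.
  rewrite le_eqVlt => /orP[/eqP <- _|z0 z1]; first exact: powR_ge0.
  by apply: ger1_powR => //; rewrite z0.
rewrite vE -[leLHS](subrKC w 1) lerD ?p1 ?(ltW w0)//.
by rewrite gerBl ltW.
Qed.

Lemma expectation_weibull_kernel_le b t : 0 <= b ->
  (\int[P]_x (weibull_kernel b (t - X x))%:E <=
   (euler_gamma (b + 1) * euler_gamma (a + 1) / euler_gamma (b + a + 1)
    * weibull_kernel (b + a) t)%:E)%E.
Proof.
move=> b0; rewrite EFinM -beta_integralE//.
have int0 : (0 <= \int[mu]_v (beta_density a b v)%:E)%E.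
  by apply: integral_ge0 => v _; rewrite lee_fin beta_density_ge0.
have [t0|t0] := leP t 0.
  rewrite integral0_eq; first by rewrite mule_ge0// lee_fin weibull_kernel_ge0.
  move=> x _; rewrite /weibull_kernel leNgt subr_lt0.
  by rewrite (le_lt_trans t0 (X_gt0 x)).
have mg : measurable_fun [set: R] (fun y => (weibull_kernel b (t - y))%:E).
  apply/measurable_EFinP.
  apply: (measurableT_comp (measurable_weibull_kernel b)).
  by measurability.
rewrite (ge0_expectation_weibull mg); last first.
  by move=> y; rewrite lee_fin weibull_kernel_ge0.
set c := weibull_hazard a l t.
have c0 : 0 < c by rewrite powR_gt0// divr_gt0.
pose f (u : R) : R := if 0 < u
  then weibull_kernel b (t - weibull_quantile u) * expR (- u) else 0.
have f0 u : 0 <= f u.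
  rewrite /f; case: ifP => // _.
  by rewrite mulr_ge0 ?weibull_kernel_ge0 ?expR_ge0.
have mf : measurable_fun [set: R] (fun u => (f u)%:E).
  apply/measurable_EFinP; rewrite /f; apply: measurable_fun_ifT => //.
    by measurability.
  apply: measurable_funM; last by measurability.
  apply: (measurableT_comp (measurable_weibull_kernel b)).
  by apply: measurable_funB => //; exact: measurable_weibull_quantile.
rewrite integral_mkcond.
rewrite (_ : integral _ _ _ = (\int[mu]_u (f u)%:E)%E); last first.
  apply: eq_integral => u _; rewrite patchE mem_setE in_itv/= andbT /f.
  by case: ifP.
rewrite (ge0_integral_affine 0 c0)//.
have K0 : 0 <= (t / l) `^ b * expR (- c).
  by rewrite mulr_ge0 ?powR_ge0 ?expR_ge0.
apply: (@le_trans _ _ (c%:E * \int[mu]_v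
    (((t / l) `^ b * expR (- c))%:E * (beta_density a b v)%:E))%E).
  rewrite lee_pmul2l ?lte_fin//; apply: ge0_le_integral => //.
  - by move=> v _; rewrite lee_fin f0.
  - apply: (measurableT_comp mf); exact: measurable_affine.
  - apply: emeasurable_funM => //; apply/measurable_EFinP.
    exact: measurable_beta_density.
  - move=> v _; rewrite -EFinM lee_fin addr0 /f pmulr_rgt0//.
    case: ifP => [v0|_]; last by rewrite mulr_ge0// beta_density_ge0.
    exact: weibull_kernel_quantile_le.
rewrite ge0_integralZl//; first last.
- by move=> v _; rewrite lee_fin beta_density_ge0.
- by apply/measurable_EFinP; exact: measurable_beta_density.
rewrite muleA [leRHS]muleC lee_wpmul2r// -EFinM lee_fin.
rewrite /weibull_kernel (ltW t0) powRD; last first.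
  by apply/implyP => _; rewrite gt_eqF// divr_gt0.
by rewrite mulrCA mulrA.
Qed.

End weibull_law.

(** * Sums of independent waiting times *)

Section partial_sums.
Context d (T : measurableType d) {R : realType} (P : probability T R).
Variable X : nat -> {RV P >-> R}.
Hypothesis indepX : independent_RVs X.

Definition partial_sum n (x : T) : R := \sum_(i < n) X i x.

Lemma partial_sum0 x : partial_sum 0 x = 0.
Proof. exact: big_ord0. Qed.

Lemma partial_sumS n x : partial_sum n.+1 x = partial_sum n x + X n x.
Proof. exact: big_ord_recr. Qed.

Lemma measurable_partial_sum n : measurable_fun [set: T] (partial_sum n).
Proof.
elim: n => [|n ih].
  rewrite (_ : partial_sum 0 = cst 0)//.
  by apply/funext => x; exact: partial_sum0.
rewrite (_ : partial_sum n.+1 = partial_sum n \+ X n).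
  exact: measurable_funD.
by apply/funext => x; exact: partial_sumS.
Qed.

HB.instance Definition _ n := isMeasurableFun.Build _ _ _ _ (partial_sum n)
  (measurable_partial_sum n).

Lemma measurable_partial_sum_jump k t :
  measurable [set x | partial_sum k x <= t < partial_sum k.+1 x].
Proof.
have mS i := measurable_partial_sum i.
have := measurable_and
  (measurable_fun_ler (mS k) (@measurable_cst _ _ _ _ setT t))
  (measurable_fun_ltr (@measurable_cst _ _ _ _ setT t) (mS k.+1)).
by move=> /(_ measurableT [set true] I); rewrite setTI; congr measurable.
Qed.

Let evt i (A : set T) := g_sigma_algebra_preimage (X i) A.

Let measurable_evt i A : evt i A -> measurable A.
Proof. by move=> [B mB <-]; exact: (measurable_funPT (X i)). Qed.

Let measurable_cap (J : {fset nat}) (A : nat -> set T) :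
  (forall i, i \in J -> evt i (A i)) ->
  measurable (\bigcap_(i in [set` J]) A i).
Proof.
move=> JA; apply: fin_bigcap_measurable; first exact: finite_fset.
by move=> i iJ; exact: measurable_evt (JA i iJ).
Qed.

Let bigcap_fset1U (n : nat) (J : {fset nat}) (B : set T) (A : nat -> set T) :
  n \notin J ->
  \bigcap_(i in [set` (n |` J)%fset]) (if i == n then B else A i) =
  B `&` \bigcap_(i in [set` J]) A i.
Proof.
move=> nJ; apply/seteqP; split => x.
  move=> Ax; split.
    by have := Ax n; rewrite /= in_fset1U eqxx; exact.
  move=> i /= iJ; have := Ax i; rewrite /= in_fset1U iJ orbT => /(_ isT).
  by case: eqP => // ni; rewrite -ni iJ in nJ.
move=> [Bx Ax] i /=; rewrite in_fset1U; case: eqP => //= _; exact: Ax.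
Qed.

Local Open Scope ereal_scope.

(** Induction on n with J arbitrary, because the step from n to n.+1 uses the hypothesis with the
    index n moved into J. *)
Lemma indep_partial_sum n (B : set R) (J : {fset nat}) (A : nat -> set T) :
  measurable B -> (forall i, i \in J -> (n <= i)%N) ->
  (forall i, i \in J -> evt i (A i)) ->
  P (partial_sum n @^-1` B `&` \bigcap_(i in [set` J]) A i) =
  P (partial_sum n @^-1` B) * P (\bigcap_(i in [set` J]) A i).
Proof.
elim: n B J A => [|n ih] B J A mB nJ JA.
  have [B0|B0] := pselect (B 0%R).
    rewrite (_ : _ @^-1` _ = setT).
      by rewrite setTI probability_setT mul1e.
    by apply/seteqP; split => // x _; rewrite /= partial_sum0.
  rewrite (_ : _ @^-1` _ = set0); first by rewrite set0I measure0 mul0e.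
  by apply/seteqP; split => // x; rewrite /= partial_sum0.
set D := \bigcap_(i in _) _.
have mD : measurable D by exact: measurable_cap.
pose Z x := (partial_sum n x, X n x).
have mZ : measurable_fun [set: T] Z.
  by apply/measurable_fun_pairP; split; [exact: measurable_partial_sum|].
have nnJ : n \notin J by apply/negP => /nJ; rewrite ltnn.
(* [m1] is the law of [Z] restricted to [D], [m2] the law of [Z] times P(D). Agreement on rectangles
   extends to all measurable sets, in particular to the half-plane-like set where the sum of the
   coordinates lies in [B]. *)
pose m1 : measure (R * R)%type R := image_measure (mrestr P mD) mZ.
have PD0 : (0 <= fine (P D))%R by exact: fine_ge0.
pose m2 : measure (R * R)%type R := mscale (NngNum PD0)
  (image_measure P mZ).
have m12 E : measurable E -> m1 E = m2 E.
  move=> mE.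
  apply: (@measure_unique _ R (R * R)%type
    [set A `*` B | A in measurable & B in measurable] (fun=> setT)
    _ _ _ _ m1 m2) => //.
  - exact: measurable_prod_measurableType.
  - move=> _ _ [A1 mA1 [A2 mA2 <-]] [B1 mB1 [B2 mB2 <-]].
    rewrite -setXI; exists (A1 `&` B1); first exact: measurableI.
    by exists (A2 `&` B2) => //; exact: measurableI.
  - by move=> _; exists setT => //; exists setT => //; rewrite setXTT.
  - by rewrite bigcup_const.
  - move=> _ [B1 mB1 [B2 mB2 <-]].
    change (P (partial_sum n @^-1` B1 `&` X n @^-1` B2 `&` D) =
      (fine (P D))%:E * P (partial_sum n @^-1` B1 `&` X n @^-1` B2)).
    rewrite fineK ?fin_num_measure//.
    have evtn : evt n (X n @^-1` B2) by exists B2 => //; rewrite setTI.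
    pose A' i := if i == n then X n @^-1` B2 else A i.
    have A'J i : i \in (n |` J)%fset -> evt i (A' i).
      rewrite in_fset1U /A'; case: eqP => [->//|_] /=; exact: JA.
    have PA' : P (X n @^-1` B2 `&` D) = P (X n @^-1` B2) * P D.
      rewrite -(bigcap_fset1U _ _ nnJ) indepX// big_fsetU1//= eqxx indepX//.
      congr (_ * _); apply: eq_big_seq => i iJ; case: eqP => // ni.
      by rewrite -ni iJ in nnJ.
    have -> : P (partial_sum n @^-1` B1 `&` X n @^-1` B2) =
        P (partial_sum n @^-1` B1) * P (X n @^-1` B2).
      have := ih B1 [fset n]%fset (fun=> X n @^-1` B2) mB1.
      rewrite (_ : [set` [fset n]%fset] = [set n]) ?bigcap_set1; last first.
        by apply/seteqP; split => i /=; rewrite inE => /eqP.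
      by apply => i; rewrite inE => /eqP ->.
    rewrite -setIA -(bigcap_fset1U _ _ nnJ) ih//; last first.
      by move=> i; rewrite in_fset1U => /predU1P[->//|/nJ/ltnW].
    by rewrite bigcap_fset1U// PA' muleA muleC.
  - move=> _; change (P (Z @^-1` setT `&` D) < +oo).
    by rewrite preimage_setT setTI -ge0_fin_numE// fin_num_measure.
have madd : measurable_fun [set: R * R] (fun p : R * R => (p.1 + p.2)%R).
  exact: measurable_funD.
have SE : Z @^-1` ((fun p : R * R => (p.1 + p.2)%R) @^-1` B) =
    partial_sum n.+1 @^-1` B.
  by apply/seteqP; split => x; rewrite /Z /= partial_sumS.
have : P (Z @^-1` ((fun p : R * R => (p.1 + p.2)%R) @^-1` B) `&` D) =
    (fine (P D))%:E * P (Z @^-1` ((fun p : R * R => (p.1 + p.2)%R) @^-1` B)).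
  by apply: m12; rewrite -[_ @^-1` _]setTI; exact: madd.
by rewrite SE fineK ?fin_num_measure// muleC.
Qed.

Lemma indep_partial_sum_next n (B C : set R) : measurable B -> measurable C ->
  P (partial_sum n @^-1` B `&` X n @^-1` C) =
  P (partial_sum n @^-1` B) * P (X n @^-1` C).
Proof.
move=> mB mC.
have := @indep_partial_sum n B [fset n]%fset (fun=> X n @^-1` C) mB.
rewrite (_ : [set` [fset n]%fset] = [set n]) ?bigcap_set1; last first.
  by apply/seteqP; split => i /=; rewrite inE => /eqP.
apply => i; rewrite inE => /eqP ->//.
by exists C => //; rewrite setTI.
Qed.

(** By independence the joint law of the pair is the product of its marginals; Tonelli then
    integrates the last waiting time with the partial sum frozen. *)
Lemma expectation_partial_sum_next n (f : R * R -> \bar R) :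
  measurable_fun [set: R * R] f -> (forall p, 0 <= f p) ->
  \int[P]_x f (partial_sum n x, X n x) =
  \int[P]_x \int[P]_y f (partial_sum n x, X n y).
Proof.
move=> mf f0.
pose S : {RV P >-> R} := partial_sum n.
pose Z x := (partial_sum n x, X n x).
have mZ : measurable_fun [set: T] Z.
  by apply/measurable_fun_pairP; split; [exact: measurable_partial_sum|].
pose m : measure (R * R)%type R :=
  image_measure P mZ.
transitivity (\int[m]_p f p); first by rewrite ge0_integral_pushforward.
transitivity (\int[distribution P S \x distribution P (X n)]_p f p).
  apply: eq_measure_integral => A mA _.
  apply/esym/product_measure_unique => // B C mB mC.
  exact: indep_partial_sum_next.
rewrite fubini_tonelli1//.
rewrite ge0_integral_distribution//; last 2 first.
- exact: measurable_fun_fubini_tonelli_F.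
- by move=> x; apply: integral_ge0.
apply: eq_integral => x _ /=.
rewrite /fubini_F ge0_integral_distribution//.
by apply: (measurableT_comp mf); exact: measurable_pair1.
Qed.

End partial_sums.

(** * Iterated conditioning for a single type *)

Section weibull_renewal.
Context d (T : measurableType d) {R : realType} (P : probability T R).
Variables (a l : R) (X : nat -> {RV P >-> R}).
Hypotheses (a0 : 0 < a) (a1 : a <= 1) (l0 : 0 < l).
Hypothesis indepX : independent_RVs X.
Hypothesis X_gt0 : forall i x, 0 < X i x.
Hypothesis cdfX : forall i y, 0 <= y -> cdf (X i) y = (weibull_cdf a l y)%:E.

Let beta b : R :=
  euler_gamma (b + 1) * euler_gamma (a + 1) / euler_gamma (b + a + 1).

Let beta_ge0 b : 0 <= b -> 0 <= beta b.
Proof.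
move=> b0; have g0 c : 0 <= c -> 0 <= euler_gamma (c + 1) :> R.
  by move=> c0; rewrite ltW// euler_gamma_gt0.
by rewrite divr_ge0 ?mulr_ge0 ?g0 ?addr_ge0// ltW.
Qed.

(** Each denominator cancels the Gamma factor Gamma(j a + 1) of the next numerator, and the first
    such factor is Gamma(1) = 1. *)
Let prod_beta k : \prod_(j < k) beta (j%:R * a) =
  euler_gamma (a + 1) ^+ k / euler_gamma (k%:R * a + 1).
Proof.
elim: k => [|k ih]; first by rewrite big_ord0 mul0r add0r euler_gamma1 divr1.
rewrite big_ord_recr/= ih /beta.
have -> : k%:R * a + a + 1 = k.+1%:R * a + 1 by rewrite -natr1 mulrDl mul1r.
have g1 : euler_gamma (k%:R * a + 1) != 0 :> R.
  by rewrite gt_eqF// euler_gamma_gt0// mulr_ge0// ltW.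
have g2 : euler_gamma (k.+1%:R * a + 1) != 0 :> R.
  by rewrite gt_eqF// euler_gamma_gt0// mulr_ge0// ltW.
move: (euler_gamma _) (euler_gamma _) (euler_gamma _) g1 g2 => x y z x0 z0.
by rewrite exprSr; field; rewrite x0 z0.
Qed.

Local Open Scope ereal_scope.

(** Induction on k for all b: integrating out the last waiting time costs [beta b] and leaves the
    same problem with b + a and one summand fewer. *)
Lemma expectation_weibull_kernel_sum_le k b t : (0 <= b)%R ->
  \int[P]_x (weibull_kernel a l b (t - partial_sum X k x))%:E <=
  (\prod_(j < k) beta (b + j%:R * a) * weibull_kernel a l (b + k%:R * a) t)%:E.
Proof.
elim: k b => [|k ih] b b0.
  under eq_integral do rewrite partial_sum0 subr0.
rewrite integral_cst// [X in _ * X](probability_setT P).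
  by rewrite mule1 big_ord0 mul1r mul0r addr0.
pose f (p : R * R) := (weibull_kernel a l b (t - (p.1 + p.2)))%:E.
have mf : measurable_fun [set: R * R] f.
  apply/measurable_EFinP.
  apply: (measurableT_comp (measurable_weibull_kernel a l b)).
  by measurability.
have f0 p : 0 <= f p by rewrite lee_fin weibull_kernel_ge0.
under eq_integral do rewrite partial_sumS.
rewrite (expectation_partial_sum_next indepX k mf f0).
have ba0 : (0 <= b + a)%R by rewrite addr_ge0// ltW.
apply: (@le_trans _ _ (\int[P]_x ((beta b)%:E *
    (weibull_kernel a l (b + a) (t - partial_sum X k x))%:E))).
  apply: ge0_le_integral => //.
  - by move=> x _; apply: integral_ge0.
  - pose g (p : T * T) := f (partial_sum X k p.1, X k p.2).
    have mg : measurable_fun [set: T * T] g.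
      apply: (measurableT_comp mf); apply/measurable_fun_pairP; split => /=.
        by apply: (measurableT_comp (measurable_partial_sum X k)).
      by apply: (measurableT_comp (measurable_funPT (X k))).
    by apply: (measurable_fun_fubini_tonelli_F g mg) => p; exact: f0.
  - apply: emeasurable_funM => //; apply/measurable_EFinP.
    apply: (measurableT_comp (measurable_weibull_kernel a l (b + a))).
    by apply: measurable_funB => //; exact: measurable_partial_sum.
  - move=> x _; rewrite -EFinM.
    (* The one-step bound is used at the remaining time, which may be negative; the kernel is then
       0. *)
    have := expectation_weibull_kernel_le a0 l0 (X_gt0 k) (cdfX k) a1
      (t - partial_sum X k x) b0.
    by apply: le_trans; rewrite /f; under eq_integral do rewrite opprD addrA.
rewrite ge0_integralZl//; last 3 first.
- apply/measurable_EFinP.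
  apply: (measurableT_comp (measurable_weibull_kernel a l (b + a))).
  by apply: measurable_funB => //; exact: measurable_partial_sum.
- by move=> x _; rewrite lee_fin weibull_kernel_ge0.
- by rewrite lee_fin beta_ge0.
apply: (le_trans (lee_wpmul2l _ (ih _ ba0))); first by rewrite lee_fin beta_ge0.
rewrite -EFinM lee_fin big_ord_recl mul0r addr0 mulrA.
rewrite [in leRHS](eq_bigr
  (fun j : 'I_k => beta (b + a + j%:R * a)%R)); last first.
  by move=> j _; congr beta; rewrite /bump/= -natr1; ring.
by have -> : (b + k.+1%:R * a = b + a + k%:R * a)%R by rewrite -natr1; ring.
Qed.

Lemma prob_weibull_renewal_le k t : (0 <= t)%R ->
  P [set x | (partial_sum X k x <= t < partial_sum X k.+1 x)%R] <=
  (euler_gamma (a + 1) ^+ k / euler_gamma (k%:R * a + 1)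
     * (t / l) `^ (k%:R * a) * expR (- weibull_hazard a l t))%:E.
Proof.
move=> t0.
pose f (p : R * R) : \bar R := (((p.1 <= t) && (t < p.1 + p.2))%R%:R)%:E.
have mb : measurable_fun [set: R * R]
    (fun p : R * R => (p.1 <= t)%R && (t < p.1 + p.2)%R).
  by measurability.
have mf : measurable_fun [set: R * R] f.
  rewrite (_ : f = fun p =>
      (if (p.1 <= t)%R && (t < p.1 + p.2)%R then 1%R else 0%R)%:E).
    by apply/measurable_EFinP; apply: measurable_fun_ifT.
  by apply/funext => p; rewrite /f; case: (_ && _).
have f0 p : 0 <= f p by rewrite lee_fin.
have mE := measurable_partial_sum_jump X k t.
rewrite -[X in P X]setIT -integral_indic//.
have -> : \int[P]_x (\1_[set x |
      (partial_sum X k x <= t < partial_sum X k.+1 x)%R] x)%:E =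
    \int[P]_x f (partial_sum X k x, X k x).
  apply: eq_integral => x _; rewrite indicE /f /= -partial_sumS.
  congr ((nat_of_bool _)%:R%:E).
  exact: asboolb.
rewrite (expectation_partial_sum_next indepX k mf f0).
(* Given S_k <= t, the next waiting time has to exceed t - S_k; the zero branch of the kernel covers
   S_k > t. *)
have -> : \int[P]_x \int[P]_y f (partial_sum X k x, X k y) =
    \int[P]_x (weibull_kernel a l 0 (t - partial_sum X k x))%:E.
  apply: eq_integral => x _; rewrite /f /weibull_kernel subr_ge0 /=.
  case: ifP => st; last by rewrite integral0_eq.
  rewrite powRr0 mul1r /=.
  have st0 : (0 <= t - partial_sum X k x)%R by rewrite subr_ge0.
  transitivity (ccdf (X k) (t - partial_sum X k x)).
    rewrite /ccdf /distribution /pushforward.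
    rewrite -[in RHS](setIT (X k @^-1` _)) -integral_indic//; last first.
      exact: measurable_funPTI.
    apply: eq_integral => y _; rewrite indicE /=; congr ((nat_of_bool _)%:R%:E).
    rewrite -ltrBlDl -[LHS]asboolb; congr asbool.
    by rewrite /= in_itv/= andbT.
  by rewrite ccdf_1_cdf cdfX// -EFinB; congr EFin; rewrite opprB addrC subrK.
apply: le_trans (expectation_weibull_kernel_sum_le k t (lexx 0%R)) _.
rewrite lee_fin add0r /weibull_kernel t0.
under eq_bigr do rewrite add0r.
by rewrite prod_beta !mulrA.
Qed.

End weibull_renewal.

(** * Occurrence counts *)

Lemma counting_itv1 (R : realType) m :
  @counting nat R [set j | (1 <= j <= m)%N] = m%:R%:E.
Proof.
have E : [set j | (1 <= j <= m)%N] = S @` `I_m.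
  apply/seteqP; split => [[|j]//= jm|_ [j jm <-]//]; by exists j.
have cE : ([set j | (1 <= j <= m)%N] #= `I_m)%card.
  by rewrite E; apply: inj_card_eq => i j _ _ [].
have fE : finite_set [set j | (1 <= j <= m)%N] by exists m.
by rewrite /counting asboolT// (card_fset_set cE).
Qed.

Section occurrences_events.
Context d (T : measurableType d) (R : realType) (P : probability T R).
Variables (W : countType) (Y : W -> nat -> {RV P >-> R}).
Hypothesis Y_gt0 : forall w i x, 0 < Y w i x.

Let le_counting (A B : set nat) :
  A `<=` B -> (@counting nat R A <= counting B)%E.
Proof. by move=> AB; apply: le_measure; rewrite ?inE. Qed.

Let partial_sum_le w x :
  {homo (partial_sum (Y w))^~ x : m n / (m <= n)%N >-> m <= n}.
Proof.
apply: homo_leq => // [? ? ?|n]; first exact: le_trans.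
by rewrite partial_sumS lerDl ltW.
Qed.

(** As partial sums increase, all counted indices lie between 1 and n. *)
Let occurrences_le w t x n : t < partial_sum (Y w) n.+1 x ->
  (occurrences Y w t x <= n%:R%:E)%E.
Proof.
move=> tn; rewrite -counting_itv1; apply: le_counting => j /= [-> jt] /=.
rewrite leqNgt; apply: contraTN jt => nj.
by rewrite -ltNge (lt_le_trans tn)// partial_sum_le.
Qed.

Let occurrences_ge w t x n : partial_sum (Y w) n x <= t ->
  (n%:R%:E <= occurrences Y w t x)%E.
Proof.
move=> nt; rewrite -counting_itv1; apply: le_counting => j /= /andP[-> jn].
by split => //; apply: le_trans nt; exact: partial_sum_le.
Qed.

Lemma occurrences_eqE w t x k : (1 <= k)%N ->
  occurrences Y w t x = k%:R%:E <->
  partial_sum (Y w) k x <= t < partial_sum (Y w) k.+1 x.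
Proof.
case: k => // k _; split => [E|/andP[kt tk]]; last first.
  by apply/eqP; rewrite eq_le occurrences_le// occurrences_ge.
apply/andP; split.
  rewrite leNgt; apply/negP => /occurrences_le; rewrite E lee_fin ler_nat.
  by rewrite ltnn.
rewrite ltNge; apply/negP => /occurrences_ge; rewrite E lee_fin ler_nat.
by rewrite ltnn.
Qed.

Lemma occurrences_gt0E w t x : (0 < occurrences Y w t x)%E <-> Y w 0 x <= t.
Proof.
have S1 : partial_sum (Y w) 1 x = Y w 0 x.
  by rewrite partial_sumS partial_sum0 add0r.
rewrite -S1; split => [|/occurrences_ge]; last first.
  by apply: lt_le_trans; rewrite lte_fin.
by apply: contraTT; rewrite -ltNge => /occurrences_le; rewrite -leNgt.
Qed.

End occurrences_events.

(** * Expectations of the counts and conclusion *)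

Lemma ge0_integral_esum d (T : measurableType d) (R : realType)
    (m : {measure set T -> \bar R}) (W : countType) (f : W -> T -> \bar R) :
  (forall w, measurable_fun [set: T] (f w)) -> (forall w x, 0 <= f w x)%E ->
  (\int[m]_x (\esum_(w in [set: W]) f w x) =
   \esum_(w in [set: W]) \int[m]_x f w x)%E.
Proof.
move=> mf f0.
(* Along the codes of types the exchange becomes that of an integral with a series of nonnegative
   functions. *)
pose g n x := oapp (f^~ x) 0%E (@pickle_inv W n).
have gE x : (\esum_(w in [set: W]) f w x = \sum_(n <oo) g n x)%E.
  rewrite esum_counting// ge0_integral_count// => n.
  by case: pickle_inv => /=.
under eq_integral do rewrite gE.
rewrite integral_nneseries//; last 2 first.
- by move=> n; rewrite /g; case: pickle_inv => [w|] /=.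
- by move=> n x _; rewrite /g; case: pickle_inv => /=.
rewrite esum_counting; last by move=> w; exact: integral_ge0.
rewrite ge0_integral_count; last first.
  by move=> n; case: pickle_inv => //= w; exact: integral_ge0.
apply: eq_eseriesr => n _; rewrite /g; case: pickle_inv => //=.
exact: integral0.
Qed.

Lemma mean_num_typesE (R : realType) (d : measure_display)
    (T : measurableType d) (P : probability T R) (W : countType)
    (lam alpha : W -> R) (Y : W -> nat -> {RV P >-> R}) (t : R) :
  weibull_source lam alpha Y -> 0 < t ->
  mean_num_types Y t =
    \esum_(w in [set: W]) (weibull_cdf (alpha w) (lam w) t)%:E.
Proof.
move=> [Y_gt0 cdfY _ _] t0.
rewrite /mean_num_types /num_types.
(* An indicator on types at a fixed outcome is reread as an indicator on outcomes at a fixed type,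
   ready for integration. *)
have E w x : \1_[set v | (0 < occurrences Y v t x)%E] w =
    \1_(Y w 0 @^-1` `]-oo, t]) x :> R.
  rewrite !indicE; congr ((nat_of_bool _)%:R); congr asbool; apply/propext.
  by rewrite /= in_itv/=; exact: occurrences_gt0E.
have mE w : measurable (Y w 0 @^-1` `]-oo, t]) by exact: measurable_funPTI.
under eq_integral do under eq_esum do rewrite E.
rewrite ge0_integral_esum//; last first.
  by move=> w; apply/measurable_EFinP; exact: measurable_indic.
apply: eq_esum => w _; rewrite integral_indic// setIT.
by rewrite -[LHS]/(cdf (Y w 0) t) cdfY// ltW.
Qed.

Lemma mean_spectrumE (R : realType) (d : measure_display)
    (T : measurableType d) (P : probability T R) (W : countType)
    (Y : W -> nat -> {RV P >-> R}) (t : R) (k : nat) :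
  (forall w i x, 0 < Y w i x) -> (1 <= k)%N ->
  mean_spectrum Y t k =
    \esum_(w in [set: W])
      P [set x | partial_sum (Y w) k x <= t < partial_sum (Y w) k.+1 x].
Proof.
move=> Y_gt0 k1; rewrite /mean_spectrum /spectrum.
have E w x : \1_[set v | occurrences Y v t x = k%:R%:E] w =
    \1_[set x | partial_sum (Y w) k x <= t < partial_sum (Y w) k.+1 x] x :> R.
  rewrite !indicE; congr ((nat_of_bool _)%:R); congr asbool; apply/propext.
  exact: occurrences_eqE.
have mE w := measurable_partial_sum_jump (Y w) k t.
under eq_integral do under eq_esum do rewrite E.
rewrite ge0_integral_esum//; last first.
  by move=> w; apply/measurable_EFinP; exact: measurable_indic.
by apply: eq_esum => w _; rewrite integral_indic// setIT.
Qed.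

Lemma weibull_hazardX (R : realType) (a l s : R) k :
  weibull_hazard a l s ^+ k = (s / l) `^ (k%:R * a).
Proof.
by rewrite /weibull_hazard [k%:R * a]mulrC powRrM powR_mulrn ?powR_ge0.
Qed.

Theorem proposition31 (R : realType) (d : measure_display)
    (T : measurableType d) (P : probability T R) (W : countType)
    (lam alpha : W -> R) (Y : W -> nat -> {RV P >-> R})
    (lam_gt0 : forall w, 0 < lam w)
    (alpha_gt0_le1 : forall w, 0 < alpha w /\ alpha w <= 1)
    (source : weibull_source lam alpha Y)
    (t : R) (t_gt0 : 0 < t) (k : nat) (k_ge1 : (1 <= k)%N) :
  [/\ mean_num_types Y t =
        \esum_(w in [set: W]) (1 - expR (- ((t / lam w) `^ alpha w)))%:E,
      (mean_spectrum Y t k <=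
        \esum_(w in [set: W])
          (euler_gamma (alpha w + 1) ^+ k / euler_gamma (k%:R * alpha w + 1)
           * (t / lam w) `^ (k%:R * alpha w)
           * expR (- ((t / lam w) `^ alpha w)))%:E)%E
    & (forall s : R, 0 < s -> (mean_num_types Y s < +oo)%E) ->
      (forall (j : nat) (s : R), (j < k)%N -> 0 < s ->
         derivable (derive1n j (fine \o mean_num_types Y)) s 1) /\
      (\esum_(w in [set: W])
         (alpha w ^+ k * (t / lam w) `^ (k%:R * alpha w)
          * expR (- ((t / lam w) `^ alpha w)))%:E
       <= ((-1) ^+ k.+1 * t ^+ k * derive1n k (fine \o mean_num_types Y) t)%:E)%E].
Proof.
have meanE s (s0 : 0 < s) := mean_num_typesE source s0.
have [Y_gt0 cdfY indepY _] := source.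
split; first exact: meanE.
  rewrite mean_spectrumE//; apply: le_esum => w _.
  have [a0 a1] := alpha_gt0_le1 w.
  exact: (prob_weibull_renewal_le a0 a1 (lam_gt0 w) (indepY w) (Y_gt0 w)
    (cdfY w) k (ltW t_gt0)).
move=> fin_mean.
have fin_esum s : 0 < s ->
    (\esum_(w in [set: W]) (weibull_cdf (alpha w) (lam w) s)%:E < +oo)%E.
  by move=> s0; rewrite -meanE//; exact: fin_mean.
(* At positive times the mean is finite, so [fine] returns its true value and not a default. *)
have fineE s : 0 < s -> ((fine \o mean_num_types Y) s)%:E =
    \esum_(w in [set: W]) (weibull_cdf (alpha w) (lam w) s)%:E.
  move=> s0; rewrite /= meanE// fineK// ge0_fin_numE ?fin_esum//.
  by apply: esum_ge0 => w _; rewrite lee_fin weibull_cdf_ge0.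
split.
  move=> j s _ s0.
  exact: (derivable_weibull_mean lam_gt0 alpha_gt0_le1 fin_esum fineE).
case: k k_ge1 => // n _.
have := derive1n_weibull_mean_ge lam_gt0 alpha_gt0_le1 fin_esum fineE n t_gt0.
by under eq_esum do rewrite weibull_hazardX.
Qed.
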